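(* Let $\kappa$ be a regular infinite cardinal and $\mu$ a singular cardinal with $\mathrm{cf}(\mu)=\kappa$. The spaces $({}^{\mu}\kappa,\kappa)$ and $({}^{\mu}\mu,\kappa)$ are homeomorphic if and only if $\mu\le 2^{<\kappa}$.
   Context: For ordinals $\delta,\rho$, ${}^{\delta}\rho$ is the set of functions $\delta\to\rho$; for a partial function $s\colon\delta\rightharpoonup\rho$, $[s]=\{f\in{}^{\delta}\rho: s\subseteq f\}$. The ${<}\kappa$-box topology on ${}^{\delta}\rho$ has base $\{[s]: |\mathrm{dom}(s)|<\kappa\}$; $(X,\kappa)$ denotes $X$ with this topology. *)

(* Defs.v *)
(* Ordinals/cardinals are modelled as types carrying a strict
   well-order; cardinalities of types are compared via injections/bijections. *)
From Stdlib Require Import List Wellfounded.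
Set Implicit Arguments.
Unset Strict Implicit.

Definition card_le (A B : Type) : Prop :=
  exists f : A -> B, forall x y, f x = f y -> x = y.
Definition card_lt (A B : Type) : Prop := card_le A B /\ ~ card_le B A.
Definition card_eq (A B : Type) : Prop :=
  exists (f : A -> B) (g : B -> A),
    (forall x, g (f x) = x) /\ (forall y, f (g y) = y).

Definition infinite (T : Type) : Prop :=
  forall l : list T, exists x, ~ In x l.

Definition is_wellorder (T : Type) (R : T -> T -> Prop) : Prop :=
  (forall x, ~ R x x) /\
  (forall x y z, R x y -> R y z -> R x z) /\
  (forall x y, R x y \/ x = y \/ R y x) /\
  well_founded R.

Definition seg (T : Type) (R : T -> T -> Prop) (x : T) : Type := {y : T | R y x}.

Definition is_cardinal (T : Type) (R : T -> T -> Prop) : Prop :=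
  is_wellorder R /\ forall x, card_lt (seg R x) T.

Definition cofinal (T : Type) (R : T -> T -> Prop) (C : T -> Prop) : Prop :=
  forall x, exists y, C y /\ (R x y \/ x = y).

Definition cofinality_is (T : Type) (R : T -> T -> Prop) (K : Type) : Prop :=
  (exists C, cofinal R C /\ card_eq {x : T | C x} K) /\
  (forall C, cofinal R C -> card_le K {x : T | C x}).

Definition regular (T : Type) (R : T -> T -> Prop) : Prop :=
  cofinality_is R T.

(* |M| <= 2^{<kappa} = sup { 2^lambda : lambda < kappa }, where the sup is the
   least upper bound: |M| is below every upper bound of the 2^|x| (x < kappa). *)
Definition le_two_pow_lt (M : Type) (K : Type) (RK : K -> K -> Prop) : Prop :=
  forall N : Type, (forall x : K, card_le (seg RK x -> bool) N) -> card_le M N.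

(* open sets of the <Kc-box topology on X -> Y: generated by the basic sets
   [s] = {h | s subset h}, |dom s| < |Kc|.  U is open iff every f in U has a
   basic neighbourhood [f|D] inside U. *)
Definition box_open (Kc X Y : Type) (U : (X -> Y) -> Prop) : Prop :=
  forall f, U f ->
    exists D : X -> Prop, card_lt {x : X | D x} Kc /\
      forall h, (forall x, D x -> h x = f x) -> U h.

Definition box_homeomorphic (Kc X1 Y1 X2 Y2 : Type) : Prop :=
  exists (F : (X1 -> Y1) -> (X2 -> Y2)) (G : (X2 -> Y2) -> (X1 -> Y1)),
    (forall f, G (F f) = f) /\ (forall g, F (G g) = g) /\
    (forall V, box_open Kc V -> box_open Kc (fun f => V (F f))) /\
    (forall U, box_open Kc U -> box_open Kc (fun g => U (G g))).

(* Main.v *)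
(** Write [S] for the space [K^M].  A partition of [S] into [M] clopen copies of
    [S] gives, by taking [M]-th powers and using [S = S^M],
    [S = (M * S)^M = M^M * S^M = M^M * S = (M * K)^M = M^M], with [M] discrete.
    Such a partition exists when [M <= 2^{<K}]: first split [S] into [K] copies
    of itself, then split the [i]-th copy according to its restriction to [i]
    coordinates, which gives [K^{<K}] pieces; the number of pieces can be
    multiplied by [M <= K^{<K}] without changing it.
    Conversely [M^M] contains [M] disjoint nonempty open sets, while a family of
    disjoint nonempty open sets of [S] has at most [K^{<K} = 2^{<K}] members. *)

From mathcomp Require Import ssreflect ssrfun ssrbool boolp.
From mathcomp Require classical_sets cardinality.
From Stdlib Require Import List Lia Cantor.
Require Import Defs.

Set Implicit Arguments.
Unset Strict Implicit.

(** * Zorn's lemma and comparison of cardinalities by injections *)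

(** The chain [F] may be empty, so [P] has to hold of the empty set as well. *)
Lemma zorn_sets (T : Type) (P : (T -> Prop) -> Prop) :
  (forall F : (T -> Prop) -> Prop, (forall X, F X -> P X) ->
     (forall X Y, F X -> F Y -> (forall t, X t -> Y t) \/ (forall t, Y t -> X t)) ->
     P (fun t => exists X, F X /\ X t)) ->
  exists A, P A /\ forall B, P B -> (forall t, A t -> B t) -> forall t, B t -> A t.
Proof.
move=> chainP.
have [|A [PA maxA]] := @classical_sets.Zorn_bigcup T P.
  move=> F FP totF.
  suff -> : classical_sets.bigcup F id = (fun t => exists X, F X /\ X t) by exact: chainP.
  by apply/funext => t; apply/propext; split=> [[X FX Xt]|[X [FX Xt]]]; exists X.
exists A; split=> // B PB AB t Bt; apply: contrapT => nAt.
by apply: (maxA B) => //; split=> // /(_ _ Bt).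
Qed.

Lemma card_le_refl (A : Type) : card_le A A.
Proof. by exists id. Qed.

Lemma card_le_trans (A B C : Type) : card_le A B -> card_le B C -> card_le A C.
Proof. by move=> [f If] [g Ig]; exists (fun x => g (f x)) => x y /Ig /If. Qed.

Lemma card_le_of_rel (A B : Type) (R : A -> B -> Prop) :
  (forall a, exists b, R a b) -> (forall a a' b, R a b -> R a' b -> a = a') ->
  card_le A B.
Proof.
by move=> /choice [f Rf] injR; exists f => x y e; apply: (injR _ _ (f x)); rewrite // e.
Qed.

Lemma card_le_surj (A B : Type) (f : A -> B) : (forall b, exists a, f a = b) -> card_le B A.
Proof. by move=> surjf; apply: (@card_le_of_rel _ _ (fun b a => f a = b)) => // a a' b <- <-. Qed.

Lemma sig_inj (T : Type) (P : T -> Prop) (a b : {x | P x}) : proj1_sig a = proj1_sig b -> a = b.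
Proof. by case: a b => [x Px] [y Py] /= e; apply: eq_exist. Qed.

Lemma existT_inj (A : Type) (B : A -> Type) (a : A) (x y : B a) :
  existT B a x = existT B a y -> x = y.
Proof. by move=> e; have := projT2_eq e; rewrite (Prop_irrelevance (projT1_eq e) erefl). Qed.

Lemma card_le_sig (T : Type) (P : T -> Prop) : card_le {x | P x} T.
Proof. by exists (@proj1_sig _ _) => a b; exact: sig_inj. Qed.

(** A maximal graph of a partial injection is total on one side: otherwise a pair of two uncovered
    points could be added. *)
Lemma card_le_total (A B : Type) : card_le A B \/ card_le B A.
Proof.
pose inj2 (G : A * B -> Prop) := forall p q, G p -> G q ->
  (fst p = fst q -> p = q) /\ (snd p = snd q -> p = q).
have [|G [injG maxG]] := zorn_sets (P := inj2).
  move=> F FP totF p q [X [FX Xp]] [Y [FY Yq]].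
  by case: (totF _ _ FX FY) => [XY|YX];
    [apply: (FP Y) => //; apply: XY | apply: (FP X) => //; apply: YX].
case: (pselect (forall a, exists b, G (a, b))) => [tot|/existsNP [a na]].
  left; apply: card_le_of_rel tot _ => a a' b Ga Ga'.
  by case: (proj2 (injG _ _ Ga Ga') erefl).
case: (pselect (forall b, exists a, G (a, b))) => [tot|/existsNP [b nb]].
  right; apply: card_le_of_rel tot _ => x x' y Gb Gb'.
  by case: (proj1 (injG _ _ Gb Gb') erefl).
case: (na); exists b; apply: (maxG (fun p => G p \/ p = (a, b))); last by right.
  move=> p q [Gp| ->] [Gq| ->] //=; first exact: injG.
  - by split=> e; [case: na; exists p.2; rewrite -e | case: nb; exists p.1; rewrite -e];
      rewrite -surjective_pairing.
  - by split=> e; [case: na; exists q.2; rewrite e | case: nb; exists q.1; rewrite e];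
      rewrite -surjective_pairing.
by left.
Qed.

(** Cantor-Bernstein, transported from the version for sets; types enter it as full sets. *)
Lemma card_eq_of_le (A B : Type) : card_le A B -> card_le B A -> card_eq A B.
Proof.
have le_setT (X Y : Type) : card_le X Y ->
    cardinality.card_le (@classical_sets.setT X) (@classical_sets.setT Y).
  case=> f If.
  have /cardinality.injPex [g] :
      exists f : X -> Y, functions.set_inj (@classical_sets.setT X) f.
    by exists f => x y _ _; exact: If.
  have [h _] := @functions.injPfun _ _ _ (@classical_sets.setT Y) g (fun _ _ => I).
  exact: cardinality.inj_card_le h.
move=> /le_setT AB /le_setT BA.
have /cardinality.card_bijP [f [g fK gK]] := cardinality.Cantor_Bernstein AB BA.
pose i (X : Type) (x : X) : classical_sets.set_type (@classical_sets.setT X) :=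
  exist _ x (classical_sets.mem_set (I : classical_sets.setT x)).
have iK X (x : classical_sets.set_type (@classical_sets.setT X)) : i X (proj1_sig x) = x.
  exact: sig_inj.
exists (fun a => proj1_sig (f (i _ a))), (fun b => proj1_sig (g (i _ b))).
by split=> x; rewrite iK ?fK ?gK.
Qed.

Lemma nat_le_infinite (T : Type) : infinite T -> card_le nat T.
Proof.
move=> /choice [pick pickP].
pose l := fix l n := match n with 0 => nil | S m => pick (l m) :: l m end.
have ltP m n : m < n -> In (pick (l m)) (l n).
  by elim=> [|k _ IH] /=; [left | right].
exists (fun n => pick (l n)) => m n e.
have [lt|[//|lt]] : m < n \/ m = n \/ n < m by lia.
- by case: (pickP (l n)); rewrite -e; exact: ltP.
- by case: (pickP (l m)); rewrite e; exact: ltP.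
Qed.

Lemma finite_of_not_infinite (T : Type) : ~ infinite T -> exists l : list T, forall x, In x l.
Proof. by move=> /existsNP [l nl]; exists l => x; apply: contrapT => nx; apply: nl; exists x. Qed.

Lemma infinite_mono (A B : Type) : card_le A B -> infinite A -> infinite B.
Proof.
move=> [f If] infA l.
have [l' l'P] : exists l' : list A, forall x, In (f x) l -> In x l'.
  elim: l => [|b l [l' IH]]; first by exists nil.
  case: (pselect (exists a, f a = b)) => [[a fa]|na].
    exists (a :: l') => x /= [e|/IH ?]; [left|by right].
    by apply: If; rewrite fa.
  by exists l' => x /= [e|/IH //]; case: na; exists x.
have [x nx] := infA l'.
by exists (f x) => /l'P.
Qed.

Lemma not_infinite_prod (A B : Type) : ~ infinite A -> ~ infinite B -> ~ infinite (A * B).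
Proof.
move=> /finite_of_not_infinite [l lP] /finite_of_not_infinite [l' l'P].
move=> /(_ (list_prod l l')) [[a b]].
by case; apply: in_prod.
Qed.

Lemma card_le_sum (A B A' B' : Type) :
  card_le A A' -> card_le B B' -> card_le (A + B) (A' + B').
Proof.
move=> [f If] [g Ig].
exists (fun s => match s with inl a => inl (f a) | inr b => inr (g b) end).
by move=> [x|x] [y|y] //= [] => [/If|/Ig] ->.
Qed.

Lemma card_le_prod (A B A' B' : Type) :
  card_le A A' -> card_le B B' -> card_le (A * B) (A' * B').
Proof.
move=> [f If] [g Ig]; exists (fun p => (f p.1, g p.2)).
by move=> [x x'] [y y'] [] /If -> /Ig ->.
Qed.

Lemma card_le_sum_prod (A : Type) (a b : A) : a <> b -> card_le (A + A) (A * A).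
Proof.
move=> ab; exists (fun s => match s with inl x => (a, x) | inr x => (b, x) end).
by move=> [x|x] [y|y] [] => [ ->|e|e| ->] //; case: ab.
Qed.

(* By Zorn's lemma there is a maximal [G] that is the graph of an injective
   (multivalued) map [A * A -> A] extending a pairing of a copy of [nat].  If
   the complement of [A] contained a copy of [A], then [G] could be extended to
   two copies of [A]; so the complement injects in [A], and so does [T]. *)
Lemma card_le_square (T : Type) : infinite T -> card_le (T * T) T.
Proof.
move=> infT; have [u Iu] := nat_le_infinite infT.
(* The underlying set is read off the diagonal of [G], so [G] alone carries both the set and its
   pairing. *)
pose dom (G : (T * T) * T -> Prop) x := exists z, G ((x, x), z).
pose G0 (p : (T * T) * T) := exists m n, p = ((u m, u n), u (Cantor.to_nat (m, n))).
(* The last clause says that [G] is empty or contains [G0]; the union of the empty chain then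
   satisfies [good]. *)
pose good G := [/\ forall x y z, G ((x, y), z) -> [/\ dom G x, dom G y & dom G z],
  forall x y, dom G x -> dom G y -> exists z, G ((x, y), z),
  forall p q z, G (p, z) -> G (q, z) -> p = q &
  forall t, G t -> forall s, G0 s -> G s].
have dom0 n : dom G0 (u n) by exists (u (Cantor.to_nat (n, n))), n, n.
have good0 : good G0.
  split=> //.
  - by move=> x y z [m [n [-> -> ->]]]; split.
  - move=> x y [_ [m [n [-> _ _]]]] [_ [m' [n' [-> _ _]]]].
    by exists (u (Cantor.to_nat (m, m'))), m, m'.
  - move=> p q z [m [n [-> ->]]] [m' [n' [-> /Iu e]]].
    by case: (Cantor.to_nat_inj (m, n) (m', n') e) => -> ->.
have [|G [[G1 G2 G3 G4] maxG]] := zorn_sets (P := good).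
  move=> F FP totF; split.
  - move=> x y z [X [FX Xp]]; have [X1 _ _ _] := FP _ FX.
    by have [[a ?] [b ?] [c ?]] := X1 _ _ _ Xp; split; [exists a|exists b|exists c]; exists X.
  - move=> x y [a [X [FX Xa]]] [b [Y [FY Yb]]].
    case: (totF _ _ FX FY) => sub.
      have [_ Y2 _ _] := FP _ FY.
      by have [||z Yz] := Y2 x y; [exists a; apply: sub|exists b|exists z; exists Y].
    have [_ X2 _ _] := FP _ FX.
    by have [||z Xz] := X2 x y; [exists a|exists b; apply: sub|exists z; exists X].
  - move=> p q z [X [FX Xp]] [Y [FY Yq]].
    case: (totF _ _ FX FY) => sub.
      by have [_ _ Y3 _] := FP _ FY; apply: Y3 Yq; exact: sub.
    by have [_ _ X3 _] := FP _ FX; apply: X3 Xp _; exact: sub.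
  - move=> t [X [FX Xt]] s G0s; exists X; split=> //.
    by have [_ _ _ X4] := FP _ FX; exact: X4 Xt _ G0s.
have subG0 : forall s, G0 s -> G s.
  case: (pselect (exists t, G t)) => [[t Gt]|nG]; first exact: G4 Gt.
  by apply: maxG => // t Gt; case: nG; exists t.
have domu n : dom G (u n) by case: (dom0 n) => z /subG0; exists z.
pose A := {x | dom G x}.
have ex_f (p : A * A) : exists z : A, G ((proj1_sig p.1, proj1_sig p.2), proj1_sig z).
  case: p => [[x dx] [y dy]]; have [z Gz] := G2 _ _ dx dy.
  by have [_ _ dz] := G1 _ _ _ Gz; exists (exist _ z dz).
have [f fP] := choice ex_f.
have If : forall p q, f p = f q -> p = q.
  move=> p q e; have := fP p; rewrite e => /G3 /(_ (fP q)).
  case: p q {e} => [[x dx] [y dy]] [[x' dx'] [y' dy']] /= [ex ey].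
  by congr (_, _); apply: sig_inj.
pose uA n : A := exist _ (u n) (domu n).
have IuA m n : uA m = uA n -> m = n by move=> [/Iu].
have sqA : card_le (A * A) A by exists f.
case: (card_le_total {x | ~ dom G x} A) => [compl|[g Ig]].
  have TA : card_le T A.
    apply: card_le_trans sqA.
    apply: card_le_trans (@card_le_sum_prod _ (uA 0) (uA 1) _); last by move=> /IuA.
    apply: card_le_trans (card_le_sum (card_le_refl A) compl).
    apply: (@card_le_surj _ _ (fun s =>
      match s with inl x => proj1_sig x | inr x => proj1_sig x end)).
    by move=> x; case: (pselect (dom G x)) => dx;
      [exists (inl (exist _ x dx))|exists (inr (exist _ x dx))].
  apply: card_le_trans (card_le_prod TA TA) _; apply: card_le_trans sqA _.
  exact: card_le_sig.
(* The copy of [A] tagged [false] is [A] itself; the one tagged [true] lies in the complement, via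
   [g]. *)
pose e (p : A * bool) : T := if p.2 then proj1_sig (g p.1) else proj1_sig p.1.
have Ie : forall p q, e p = e q -> p = q.
  move=> [a [|]] [b [|]]; rewrite /e /=.
  - by move=> /sig_inj /Ig ->.
  - by case: (g a) => x nx /= xb; case: nx; rewrite xb; case: b {xb}.
  - by case: (g b) => x nx /= xb; case: nx; rewrite -xb; case: a {xb}.
  - by move=> /sig_inj ->.
(* Three values separate the kinds of pairs with a component in the new copy; the remaining pairs
   keep their value under [G]. New values lie in the new copy, so they meet no old value. *)
pose tag (p : bool * bool) : A :=
  uA (match p with (true, true) => 2 | (true, false) => 1 | _ => 0 end).
have Itag i j i' j' : i || j -> i' || j' -> tag (i, j) = tag (i', j') -> (i, j) = (i', j').
  by move: i j i' j' => [] [] [] [] //= _ _ /IuA.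
pose new (p : (T * T) * T) := exists a b i j, i || j /\
  p = ((e (a, i), e (b, j)), e (f (f (a, b), tag (i, j)), true)).
pose G' p := G p \/ new p.
have dome a i : dom G' (e (a, i)).
  case: i; last by have [z Gz] := proj2_sig a; exists z; left.
  by exists (e (f (f (a, a), tag (true, true)), true)); right; exists a, a, true, true.
have domG' x : dom G' x -> exists p, x = e p.
  case=> z [Gz|[a [b [i [j [_ [-> _ _]]]]]]]; last by exists (a, i).
  have dx : dom G x by exists z.
  by exists (exist _ x dx, false).
have domGe x : dom G x -> exists a, x = e (a, false).
  by move=> dx; exists (exist _ x dx).
have goodG' : good G'.
  split.
  - move=> x y z [Gz|[a [b [i [j [_ [-> -> ->]]]]]]]; last by split; exact: dome.
    have [/domGe [a ->] /domGe [b ->] /domGe [c ->]] := G1 _ _ _ Gz.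
    by split; exact: dome.
  - move=> x y /domG' [[a i] ->] /domG' [[b j] ->].
    case ij : (i || j).
      by exists (e (f (f (a, b), tag (i, j)), true)); right; exists a, b, i, j.
    move: i j ij => [] [] // _.
    by exists (proj1_sig (f (a, b))); left; exact: (fP (a, b)).
  - have GN x y x' y' z : G ((x, y), z) -> new ((x', y'), z) -> False.
      move=> Gz [a [b [i [j [_ [_ _ ez]]]]]].
      have [_ _ /domGe [c ec]] := G1 _ _ _ Gz.
      by move: ez; rewrite ec => /Ie.
    move=> [x y] [x' y'] z [Gp|Np] [Gq|Nq].
    + exact: G3 Gp Gq.
    + by case: (GN _ _ _ _ _ Gp Nq).
    + by case: (GN _ _ _ _ _ Gq Np).
    move: Np Nq => [a [b [i [j [ij [-> -> ->]]]]]] [a' [b' [i' [j' [ij' [-> -> /Ie []]]]]]].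
    move=> /If ez; have [-> ->] := If _ _ (f_equal fst ez).
    by have [-> ->] := Itag _ _ _ _ ij ij' (f_equal snd ez).
  - by move=> t _ s /subG0 Gs; left.
have [z] := dome (uA 0) true.
move=> /(maxG _ goodG' (fun t Gt => or_introl Gt)) Gz.
have /domGe [a] : dom G (e (uA 0, true)) by exists z.
by move=> /Ie.
Qed.

(** * Absorption laws and strict inequalities of cardinals *)

Lemma card_eq_sym (A B : Type) : card_eq A B -> card_eq B A.
Proof. by move=> [f [g [fK gK]]]; exists g, f. Qed.

Lemma infinite_two (T : Type) : infinite T -> exists a b : T, a <> b.
Proof.
move=> infT; have [a _] := infT nil; have [b nb] := infT (a :: nil).
by exists a, b => e; apply: nb; left.
Qed.

Lemma card_eq_sum_absorb (A B : Type) : infinite B -> card_le A B -> card_eq (A + B) B.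
Proof.
move=> infB AB; apply: card_eq_of_le; last by exists inr => x y [].
have [a [b ab]] := infinite_two infB.
apply: card_le_trans (card_le_sum AB (card_le_refl B)) _.
exact: card_le_trans (card_le_sum_prod ab) (card_le_square infB).
Qed.

Lemma card_eq_prod_absorb (A B : Type) :
  infinite B -> A -> card_le A B -> card_eq (A * B) B.
Proof.
move=> infB a AB; apply: card_eq_of_le; last by exists (pair a) => x y [].
exact: card_le_trans (card_le_prod AB (card_le_refl B)) (card_le_square infB).
Qed.

(** Diagonal argument on an injection: [d] is false at [a] exactly when some [f] coded by [a] is
    true there, and its value at [j d] is contradictory. *)
Lemma cantor (A : Type) : ~ card_le (A -> bool) A.
Proof.
move=> [j Ij]; pose d a := `[< forall f, j f = a -> f a = false >].
have dj : d (j d) = true.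
  apply/asboolP => f /Ij ->; case E : (d (j d)) => //.
  by move/asboolP: (E) => /(_ d erefl); rewrite E.
by move/asboolP: (dj) => /(_ d erefl); rewrite dj.
Qed.

Lemma card_lt_of_not_le (A B : Type) : ~ card_le B A -> card_lt A B.
Proof. by move=> nBA; split=> //; case: (card_le_total A B). Qed.

Lemma card_le_lt_trans (A B C : Type) : card_le A B -> card_lt B C -> card_lt A C.
Proof. by move=> AB [_ nCB]; apply: card_lt_of_not_le => /card_le_trans /(_ AB). Qed.

Lemma card_lt_infinite (A B : Type) : ~ infinite A -> infinite B -> card_lt A B.
Proof. by move=> finA infB; apply: card_lt_of_not_le => /infinite_mono /(_ infB). Qed.

(** The larger factor decides: its square is no larger than itself if it is infinite, and finite
    otherwise. *)
Lemma card_lt_prod (A B C : Type) : infinite C -> card_lt A C -> card_lt B C -> card_lt (A * B) C.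
Proof.
have square X : infinite C -> card_lt X C -> card_lt (X * X) C.
  move=> infC XC; case: (pselect (infinite X)) => [infX|finX].
    exact: card_le_lt_trans (card_le_square infX) XC.
  exact: card_lt_infinite (not_infinite_prod finX finX) infC.
move=> infC AC BC; case: (card_le_total A B) => le.
  exact: card_le_lt_trans (card_le_prod le (card_le_refl B)) (square _ infC BC).
exact: card_le_lt_trans (card_le_prod (card_le_refl A) le) (square _ infC AC).
Qed.

(** * Sets of fewer than [K] elements *)

Definition small (K X : Type) (D : X -> Prop) : Prop := card_lt {x | D x} K.

Lemma small_sub (K X : Type) (D E : X -> Prop) :
  (forall x, D x -> E x) -> small K E -> small K D.
Proof.
move=> DE; apply: card_le_lt_trans.
exists (fun p : {x | D x} => exist E (proj1_sig p) (DE _ (proj2_sig p))).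
by move=> p q [] /sig_inj.
Qed.

Lemma small_range (K J X : Type) (f : J -> X) :
  card_lt J K -> small K (fun x => exists j, x = f j).
Proof.
apply: card_le_lt_trans.
apply: (@card_le_of_rel _ _ (fun p j => proj1_sig p = f j)) => [[x [j xj]]|p q j e e'];
  first by exists j.
by apply: sig_inj; rewrite e e'.
Qed.

Lemma card_lt_unit (K : Type) : infinite K -> card_lt unit K.
Proof. by apply: card_lt_infinite => /(_ (tt :: nil)) [[]]; case; left. Qed.

Lemma small_eq (K X : Type) (a : X) : infinite K -> small K (fun x => x = a).
Proof.
move=> /card_lt_unit /(small_range (fun _ : unit => a)).
by apply: small_sub => x ->; exists tt.
Qed.

(** * Spaces, their products and powers *)

(* A topology presented by subbasic clopen sets: the sets [agree i x], for [i]
   an index, generate the neighbourhoods of [x].  Intersections of fewer than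
   [K] of them form the base, as for the box topology. *)
Record space := Space {
  point : Type;
  index : Type;
  agree : index -> point -> point -> Prop }.

Arguments agree : clear implicits.

Definition discrete (A : Type) : space := @Space A unit (fun _ => eq).

Definition product (X Y : space) : space :=
  @Space (point X * point Y) (index X + index Y) (fun k p q =>
    match k with inl i => agree X i p.1 q.1 | inr j => agree Y j p.2 q.2 end).

(** Basic sets restrict fewer than [K] indices in all, so an iterated power carries the same
    topology as a single power over the product of the exponents. *)
Definition power (L : Type) (X : space) : space :=
  @Space (L -> point X) (L * index X) (fun k f g => agree X k.2 (f k.1) (g k.1)).

(** For regular [K] it is enough to test one target index at a time: the supports found for a small
    set of indices have a small union. *)
Definition continuous (K : Type) (X Y : space) (F : point X -> point Y) : Prop :=
  forall x j, exists D : index X -> Prop, small K D /\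
    forall x', (forall i, D i -> agree X i x x') -> agree Y j (F x) (F x').

Definition iso (K : Type) (X Y : space) : Prop :=
  exists (F : point X -> point Y) (G : point Y -> point X),
    [/\ forall x, G (F x) = x, forall y, F (G y) = y,
        continuous K F & continuous K G].

(** Terms naming the members of the closure in the chain condition. Children are indexed by a small
    subset of [K]; the label of a child is a code of a coordinate together with a value there. *)
Inductive tree (K : Type) : Type :=
  node (q : {P : K -> Prop | small K P}) (g : {k | proj1_sig q k} -> tree K)
    (h : {k | proj1_sig q k} -> K * K).

(** * Consequences of regularity for small sets *)

Section Regular.

Variables (K : Type) (RK : K -> K -> Prop).
Hypotheses (cardK : is_cardinal RK) (infK : infinite K) (regK : regular RK).

(** By regularity a cofinal set has at least [K] elements, so a small set is not cofinal; a witness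
    to this is a strict bound. *)
Lemma small_bounded (P : K -> Prop) : small K P -> exists b, forall x, P x -> RK x b.
Proof.
move=> [_ nKP]; case: regK => _ regC.
have /existsNP [b nb] : ~ cofinal RK P by move=> /regC.
exists b => x Px; case: cardK => [[_ [_ [tri _]]] _].
have [xb|[xb|bx]] := tri x b => //; case: nb; exists x; split=> //; last by left.
by right.
Qed.

Lemma card_le_seg (A : Type) : card_lt A K -> exists b, card_le A (seg RK b).
Proof.
move=> AK; case: (AK) => -[f If] _.
have [b bP] := small_bounded (small_range f AK).
by exists b, (fun a => exist (fun x => RK x b) (f a) (bP _ (ex_intro _ a erefl))) => x y [/If].
Qed.

Lemma seg_mono (b c : K) : RK b c -> card_le (seg RK b) (seg RK c).
Proof.
case: cardK => [[_ [trans _]] _] bc.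
exists (fun p : seg RK b => exist (fun x => RK x c) (proj1_sig p) (trans _ _ _ (proj2_sig p) bc)).
by move=> p q [] /sig_inj.
Qed.

(** Each [D j] injects into a segment, and the fewer than [K] endpoints have a common bound [c]. The
    union then injects into [J * seg RK c], a product of two cardinals below [K]. *)
Lemma small_union (J X : Type) (D : J -> X -> Prop) :
  card_lt J K -> (forall j, small K (D j)) -> small K (fun x => exists j, D j x).
Proof.
move=> JK DK.
have [b bP] := choice (fun j => card_le_seg (DK j)).
have [c cP] := small_bounded (small_range b JK).
have Dc j : card_le {x | D j x} (seg RK c).
  by apply: card_le_trans (bP j) (seg_mono _); apply: cP; exists j.
pose h j := proj1_sig (cid (Dc j)).
have hP j : forall x y, h j x = h j y -> x = y := proj2_sig (cid (Dc j)).
case: cardK => _ segK.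
apply: card_le_lt_trans (card_lt_prod infK JK (segK c)).
apply: (@card_le_of_rel _ _ (fun p js =>
  exists d : D js.1 (proj1_sig p), h js.1 (exist _ _ d) = js.2)).
  by move=> [x [j d]]; exists (j, h j (exist _ x d)), d.
move=> [x xd] [y yd] [j s] [/= d <-] [d' /hP [e]].
exact: sig_inj.
Qed.

Lemma small_union_sub (J X : Type) (P : J -> Prop) (D : J -> X -> Prop) :
  small K P -> (forall j, P j -> small K (D j)) -> small K (fun x => exists j, P j /\ D j x).
Proof.
move=> PK DK.
have := small_union (D := fun (p : {j | P j}) x => D (proj1_sig p) x) PK
  (fun p => DK _ (proj2_sig p)).
by apply: small_sub => x [j [Pj Dx]]; exists (exist _ j Pj).
Qed.

Lemma small_or (X : Type) (D E : X -> Prop) :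
  small K D -> small K E -> small K (fun x => D x \/ E x).
Proof.
move=> DK EK; have boolK : card_lt bool K.
  by apply: card_lt_infinite => // /(_ (true :: false :: nil)) [[]]; case; [left|right; left].
have := small_union (D := fun b : bool => if b then D else E) boolK.
move=> /(_ (fun b => match b with true => DK | false => EK end)).
by apply: small_sub => x [Dx|Ex]; [exists true|exists false].
Qed.

Lemma small_image (X Y : Type) (D : X -> Prop) (f : X -> Y) :
  small K D -> small K (fun y => exists x, D x /\ y = f x).
Proof. by move=> DK; apply: small_union_sub DK _ => x _; exact: small_eq. Qed.


(** * Calculus of isomorphisms between spaces *)

Lemma continuous_pointwise (X Y : space) (F : point X -> point Y) :
  (forall j, exists i, forall x x', agree X i x x' -> agree Y j (F x) (F x')) ->
  continuous K F.
Proof.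
move=> HF x j; have [i iP] := HF j.
exists (fun k => k = i); split; first exact: small_eq.
by move=> x' ag; apply: iP; exact: ag.
Qed.

Lemma continuous_comp (X Y Z : space) (F : point X -> point Y) (G : point Y -> point Z) :
  continuous K F -> continuous K G -> continuous K (fun x => G (F x)).
Proof.
move=> cF cG x k; have [E [EK EP]] := cG (F x) k.
have [D DP] := choice (cF x).
exists (fun i => exists j, E j /\ D j i); split.
  by apply: small_union_sub => // j _; exact: (proj1 (DP j)).
move=> x' ag; apply: EP => j Ej; apply: (proj2 (DP j)) => i Di.
by apply: ag; exists j.
Qed.

Lemma iso_refl (X : space) : iso K X X.
Proof. by exists id, id; split=> //; apply: continuous_pointwise => i; exists i. Qed.

Lemma iso_sym (X Y : space) : iso K X Y -> iso K Y X.
Proof. by move=> [F [G [FK GK cF cG]]]; exists G, F. Qed.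

Lemma iso_trans (X Y Z : space) : iso K X Y -> iso K Y Z -> iso K X Z.
Proof.
move=> [F [G [FK GK cF cG]]] [F' [G' [FK' GK' cF' cG']]].
exists (fun x => F' (F x)), (fun z => G (G' z)); split.
- by move=> x; rewrite FK' FK.
- by move=> z; rewrite GK GK'.
- exact: continuous_comp.
- exact: continuous_comp.
Qed.

Lemma iso_discrete (A B : Type) : card_eq A B -> iso K (discrete A) (discrete B).
Proof.
move=> [f [g [fK gK]]]; exists f, g; split=> //.
- by apply: continuous_pointwise => -[]; exists tt => x x' /= ->.
- by apply: continuous_pointwise => -[]; exists tt => x x' /= ->.
Qed.

Lemma iso_product (X X' Y Y' : space) :
  iso K X X' -> iso K Y Y' -> iso K (product X Y) (product X' Y').
Proof.
have cont (X1 X2 Y1 Y2 : space) (F : point X1 -> point X2) (G : point Y1 -> point Y2) :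
    continuous K F -> continuous K G ->
    @continuous K (product X1 Y1) (product X2 Y2) (fun p => (F p.1, G p.2)).
  move=> cF cG [x y] [j|j] /=.
    have [D [DK DP]] := cF x j.
    exists (fun k => exists i, D i /\ k = inl i); split; first exact: small_image.
    by move=> [x' y'] ag; apply: DP => i Di; apply: (ag (inl i)); exists i.
  have [D [DK DP]] := cG y j.
  exists (fun k => exists i, D i /\ k = inr i); split; first exact: small_image.
  by move=> [x' y'] ag; apply: DP => i Di; apply: (ag (inr i)); exists i.
move=> [F [F' [FK FK' cF cF']]] [G [G' [GK GK' cG cG']]].
exists (fun p => (F p.1, G p.2)), (fun p => (F' p.1, G' p.2)); split.
- by move=> [x y]; rewrite /= FK GK.
- by move=> [x y]; rewrite /= FK' GK'.
- exact: cont.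
- exact: cont.
Qed.

Lemma iso_power (L : Type) (X Y : space) : iso K X Y -> iso K (power L X) (power L Y).
Proof.
have cont (X1 X2 : space) (F : point X1 -> point X2) : continuous K F ->
    @continuous K (power L X1) (power L X2) (fun f l => F (f l)).
  move=> cF f [l j] /=; have [D [DK DP]] := cF (f l) j.
  exists (fun k => exists i, D i /\ k = (l, i)); split; first exact: small_image.
  by move=> f' ag; apply: DP => i Di; apply: (ag (l, i)); exists i.
move=> [F [G [FK GK cF cG]]].
exists (fun f l => F (f l)), (fun f l => G (f l)); split.
- by move=> f; apply/funext => l.
- by move=> f; apply/funext => l.
- exact: cont.
- exact: cont.
Qed.

Lemma iso_product_assoc (X Y Z : space) :
  iso K (product X (product Y Z)) (product (product X Y) Z).
Proof.
exists (fun p => ((p.1, p.2.1), p.2.2)), (fun p => (p.1.1, (p.1.2, p.2))); split.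
- by move=> [x [y z]].
- by move=> [[x y] z].
- apply: continuous_pointwise => -[[i|j]|k]; first by exists (inl i).
    by exists (inr (inl j)).
  by exists (inr (inr k)).
- apply: continuous_pointwise => -[i|[j|k]]; first by exists (inl (inl i)).
    by exists (inl (inr j)).
  by exists (inr k).
Qed.

Lemma iso_product_discrete (A B : Type) :
  iso K (product (discrete A) (discrete B)) (discrete (A * B)).
Proof.
exists id, id; split=> //.
- move=> [a b] []; exists (fun _ => True); split.
    have := small_or (small_eq (inl tt : unit + unit) infK) (small_eq (inr tt : unit + unit) infK).
    by apply: small_sub => -[[]|[]] _; [left|right].
  by move=> [a' b'] ag; congr (_, _); [exact: (ag (inl tt) I)|exact: (ag (inr tt) I)].
- by apply: continuous_pointwise => j; exists tt => -[a b] _ <-; case: j.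
Qed.

Lemma iso_power_reindex (L L' : Type) (X : space) :
  card_eq L L' -> iso K (power L X) (power L' X).
Proof.
move=> [f [g [fK gK]]]; exists (fun h l => h (g l)), (fun h l => h (f l)); split.
- by move=> h; apply/funext => l; rewrite fK.
- by move=> h; apply/funext => l; rewrite gK.
- by apply: continuous_pointwise => -[l j]; exists (g l, j).
- by apply: continuous_pointwise => -[l j]; exists (f l, j).
Qed.

Lemma iso_power_power (L L' : Type) (X : space) :
  iso K (power (L * L') X) (power L (power L' X)).
Proof.
exists (fun h l l' => h (l, l')), (fun h p => h p.1 p.2); split=> //.
- by move=> h; apply/funext => -[l l'].
- by apply: continuous_pointwise => -[l [l' j]]; exists ((l, l'), j).
- by apply: continuous_pointwise => -[[l l'] j]; exists (l, (l', j)).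
Qed.

Lemma iso_power_product (L : Type) (X Y : space) :
  iso K (power L (product X Y)) (product (power L X) (power L Y)).
Proof.
exists (fun h => (fun l => (h l).1, fun l => (h l).2)), (fun p l => (p.1 l, p.2 l)); split.
- by move=> h; apply/funext => l; rewrite -surjective_pairing.
- by move=> [f g].
- by apply: continuous_pointwise => -[[l j]|[l j]]; [exists (l, inl j)|exists (l, inr j)].
- by apply: continuous_pointwise => -[l [j|j]]; [exists (inl (l, j))|exists (inr (l, j))].
Qed.

Lemma iso_power_sum (L L' : Type) (X : space) :
  iso K (power (L + L') X) (product (power L X) (power L' X)).
Proof.
exists (fun h => (fun l => h (inl l), fun l => h (inr l))),
  (fun p s => match s with inl l => p.1 l | inr l => p.2 l end); split.
- by move=> h; apply/funext => -[l|l].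
- by move=> [f g].
- by apply: continuous_pointwise => -[[l j]|[l j]]; [exists (inl l, j)|exists (inr l, j)].
- by apply: continuous_pointwise => -[[l|l] j]; [exists (inl (l, j))|exists (inr (l, j))].
Qed.

Lemma iso_power_unit (X : space) : iso K (power unit X) X.
Proof.
exists (fun h => h tt), (fun x _ => x); split=> //.
- by move=> h; apply/funext => -[].
- by apply: continuous_pointwise => j; exists (tt, j).
- by apply: continuous_pointwise => -[l j]; exists j.
Qed.

(** Agreement on all of [L] is a small condition, so every point of the power is isolated. *)
Lemma iso_power_small (L A : Type) :
  card_lt L K -> iso K (power L (discrete A)) (discrete (L -> A)).
Proof.
move=> LK; exists id, id; split=> //.
- move=> h []; exists (fun k => exists l, k = (l, tt)); split; first exact: small_range.
  by move=> h' ag; apply/funext => l; apply: (ag (l, tt)); exists l.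
- by apply: continuous_pointwise => -[l j]; exists tt => h _ <-.
Qed.

(** Refines a partition: each of the [A] copies of [X] is split in its own way, and the maps glue
    continuously because the copies are clopen. *)
Lemma iso_product_sigma (A : Type) (B : A -> Type) (X : space) :
  (forall a, iso K X (product (discrete (B a)) X)) ->
  iso K (product (discrete A) X) (product (discrete {a : A & B a}) X).
Proof.
move=> isoX.
have [F [G FG]] : exists (F : forall a, point X -> B a * point X)
    (G : forall a, B a * point X -> point X),
    forall a, [/\ forall x, G a (F a x) = x, forall y, F a (G a y) = y,
      @continuous K X (product (discrete (B a)) X) (F a) &
      @continuous K (product (discrete (B a)) X) X (G a)].
  exists (fun a => proj1_sig (cid (isoX a))),
    (fun a => proj1_sig (cid (proj2_sig (cid (isoX a))))) => a.
  exact: proj2_sig (cid (proj2_sig (cid (isoX a)))).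
exists (fun p => (existT B p.1 (F p.1 p.2).1, (F p.1 p.2).2)),
  (fun p => (projT1 p.1, G (projT1 p.1) (projT2 p.1, p.2))); split.
- by move=> [a x] /=; rewrite -surjective_pairing; case: (FG a) => ->.
- by move=> [[a b] x] /=; case: (FG a) => _ -> /=.
- move=> [a x] /=.
  (* A neighbourhood that fixes the first coordinate sees only the map [F a]. *)
  have step k : exists D : index (product (discrete A) X) -> Prop, small K D /\
      forall p, (forall i, D i -> agree (product (discrete A) X) i (a, x) p) ->
        a = p.1 /\ agree (product (discrete (B a)) X) k (F a x) (F a p.2).
    have [_ _ cF _] := FG a; have [D [DK DP]] := cF x k.
    exists (fun i => i = inl tt \/ exists j, D j /\ i = inr j); split.
      exact: small_or (small_eq _ infK) (small_image _ DK).
    move=> p ag; split; first exact: (ag (inl tt) (or_introl erefl)).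
    by apply: DP => i Di; apply: (ag (inr i)); right; exists i.
  case=> [[]|j].
    have [D [DK DP]] := step (inl tt); exists D; split=> // -[a' x'] /DP /= [ea].
    (* Eliminating the equation of first coordinates identifies the types [B a] and [B a']. *)
    by case: _ / ea => ->.
  have [D [DK DP]] := step (inr j); exists D; split=> // -[a' x'] /DP /= [ea].
  by case: _ / ea.
- move=> [[a b] x] [[]|j] /=.
    exists (fun i => i = inl tt); split; first exact: small_eq.
    by move=> p ag; have /= <- := ag (inl tt) erefl.
  have [_ _ _ cG] := FG a; have [D [DK DP]] := cG (b, x) j.
  exists (fun i => i = inl tt \/ exists j, D (inr j) /\ i = inr j); split.
    apply: small_or (small_eq _ infK) _.
    have := small_image (fun k => match k with inl _ => inl tt | inr i => inr i end) DK.
    by apply: small_sub => _ [i [Di ->]]; exists (inr i).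
  move=> [p x'] ag; have /= ep := ag (inl tt) (or_introl erefl).
  case: _ / ep ag => ag /=; apply: DP => -[[]|i] Di //=.
  by apply: (ag (inr i)); right; exists i.
Qed.

(** * From the cardinal inequality to a homeomorphism *)

Section Homeomorphic.

Variables (M : Type).
Hypothesis (KM : card_le K M).

Let infM : infinite M := infinite_mono KM infK.

Let S : space := power M (discrete K).

Lemma iso_split_power (L : Type) :
  card_le L M -> iso K S (product (power L (discrete K)) S).
Proof.
move=> /(card_eq_sum_absorb infM) LM; apply: iso_trans _ (iso_power_sum _ _ _).
exact: iso_sym (iso_power_reindex _ LM).
Qed.

(** One coordinate of [S] gives a value [i] in [K]; on that piece a block of coordinates indexed by
    [seg RK i] is split off. The block is small, so its power is discrete. *)
Lemma iso_split_small_power :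
  iso K S (product (discrete {i : K & seg RK i -> K}) S).
Proof.
have unitM : card_le unit M.
  by have [m _] := infM nil; exists (fun _ => m) => -[] [].
apply: iso_trans (iso_split_power unitM) _.
apply: iso_trans (iso_product (iso_power_unit _) (iso_refl S)) _.
apply: iso_product_sigma => i.
apply: iso_trans (iso_split_power (card_le_trans (card_le_sig _) KM)) _.
apply: iso_product _ (iso_refl S); apply: iso_power_small; exact: (proj2 cardK i).
Qed.

(** Two elements of [K] code [bool], so the type of pieces is one of the upper bounds that [M] lies
    below. *)
Lemma le_small_power : le_two_pow_lt M RK -> card_le M {i : K & seg RK i -> K}.
Proof.
move=> le; apply: le => x; have [a [b ab]] := infinite_two infK.
exists (fun f => existT (fun i => seg RK i -> K) x (fun s => if f s then a else b)) => f g.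
move=> e'; have e := existT_inj e'; apply/funext => s.
by move: (f_equal (fun u => u s) e); case: (f s); case: (g s) => // ba; case: ab.
Qed.

Lemma iso_of_le_two_pow : le_two_pow_lt M RK -> iso K S (power M (discrete M)).
Proof.
move=> /le_small_power; set Q := (X in card_le M X) => MQ.
have infQ := infinite_mono MQ infM.
have [m _] := infM nil; have [k _] := infK nil.
(* S = Q × S = (M × Q) × S = M × (Q × S) = M × S, as [M * Q] and [Q] are equinumerous. *)
have absorb : iso K S (product (discrete M) S).
  apply: iso_trans iso_split_small_power _.
  apply: iso_trans (iso_product (iso_discrete _) (iso_refl S)) _.
    exact: card_eq_sym (card_eq_prod_absorb infQ m MQ).
  apply: iso_trans (iso_product (iso_sym (iso_product_discrete M Q)) (iso_refl S)) _.
  apply: iso_trans (iso_sym (iso_product_assoc _ _ _)) _.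
  exact: iso_product (iso_refl _) (iso_sym iso_split_small_power).
have SM : iso K S (power M S).
  apply: iso_trans _ (iso_power_power M M (discrete K)).
  apply: iso_sym; apply: iso_power_reindex.
  exact: card_eq_prod_absorb infM m (card_le_refl M).
apply: (iso_trans SM).
apply: iso_trans (iso_power M absorb) _.
apply: iso_trans (iso_power_product _ _ _) _.
(* The factor S^M becomes [S], which is K^M by definition; the two powers then merge into one power
   of M × K. *)
apply: iso_trans (iso_product (iso_refl _) (iso_sym SM)) _.
apply: iso_trans (iso_sym (iso_power_product _ _ _)) _.
apply: iso_power; apply: iso_trans (iso_product_discrete _ _) (iso_discrete _).
apply: card_eq_of_le; last by exists (fun m => (m, k)) => x y [].
exact: card_le_trans (card_le_prod (card_le_refl M) KM) (card_le_square infM).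
Qed.

End Homeomorphic.

Lemma box_homeomorphic_of_iso (X Y X' Y' : Type) :
  iso K (power X (discrete Y)) (power X' (discrete Y')) -> box_homeomorphic K X Y X' Y'.
Proof.
have cont X1 Y1 X2 Y2 (F : (X1 -> Y1) -> (X2 -> Y2)) :
    @continuous K (power X1 (discrete Y1)) (power X2 (discrete Y2)) F ->
    forall V, box_open K V -> box_open K (fun f => V (F f)).
  move=> cF V openV f /openV [E [EK EP]].
  have [D DP] := choice (fun j => cF f (j, tt)).
  exists (fun i => exists j, E j /\ D j (i, tt)); split.
    apply: small_union_sub => // j _; have [DK _] := DP j.
    by apply: small_sub (small_image fst DK) => i Di; exists (i, tt).
  move=> h ag; apply: EP => j Ej; symmetry; apply: (proj2 (DP j)) => -[i []] Di /=.
  by symmetry; apply: ag; exists j.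
move=> [F [G [FK GK cF cG]]]; exists F, G; split=> //; split=> //.
by split=> V; apply: cont.
Qed.

(** * The chain condition of K^X *)

(** A child with label [(k, v)] contributes the coordinate that [k] codes in the domain of its
    value, with [v] prescribed there; [c] is applied to the relation so collected. *)
Fixpoint tree_eval (A X : Type) (E : A -> K -> X -> Prop) (c : (X -> K -> Prop) -> A)
    (w : tree K) : A :=
  match w with
  | node _ g h => c (fun x v => exists s, E (tree_eval E c (g s)) (h s).1 x /\ v = (h s).2)
  end.

(* A node is coded as a small subset of [K * (K * K + K)], where [(k, inl r)]
   records the label of its [k]-th child and [(k, inr y)] that [y] belongs to
   the code of this child. *)
Fixpoint tree_code (u : K * (K * K + K) -> K) (w : tree K) : K -> Prop :=
  match w with
  | node _ g h => fun t => exists s, t = u (proj1_sig s, inl (h s)) \/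
      exists y, tree_code u (g s) y /\ t = u (proj1_sig s, inr y)
  end.

Lemma small_tree_code (u : K * (K * K + K) -> K) (w : tree K) : small K (tree_code u w).
Proof.
elim: w => q g IH h /=; apply: small_union (proj2_sig q) _ => s.
exact: small_or (small_eq _ infK) (small_image _ (IH s)).
Qed.

Lemma tree_code_inj (u : K * (K * K + K) -> K) :
  (forall p p', u p = u p' -> p = p') ->
  forall w w', tree_code u w = tree_code u w' -> w = w'.
Proof.
move=> Iu.
have codel q g h k r : tree_code u (@node K q g h) (u (k, inl r)) <->
    exists s, proj1_sig s = k /\ h s = r.
  split=> [[s [/Iu [-> ->]|[y [_ /Iu //]]]]|[s [<- <-]]]; first by exists s.
  by exists s; left.
have coder q g h k y : tree_code u (@node K q g h) (u (k, inr y)) <->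
    exists s, proj1_sig s = k /\ tree_code u (g s) y.
  split=> [[s [/Iu //|[y' [cy /Iu [-> ->]]]]]|[s [<- cy]]]; first by exists s.
  by exists s; right; exists y.
have dom q g h k r : tree_code u (@node K q g h) (u (k, inl r)) -> proj1_sig q k.
  by move=> /codel [s [<- _]]; exact: (proj2_sig s).
elim=> q g IH h [q' g' h'] e.
have eqv t : tree_code u (node g h) t <-> tree_code u (node g' h') t by rewrite e.
(* Every child leaves an [inl] entry even if its own code is empty, so the code determines the index
   set. *)
have eqq : q = q'.
  apply: sig_inj; apply/funext => k; apply/propext; split=> qk.
    exact: (dom _ _ _ _ _ (proj1 (eqv _)
      (proj2 (codel q g h k _) (ex_intro _ (exist _ k qk) (conj erefl erefl))))).
  exact: (dom _ _ _ _ _ (proj2 (eqv _)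
    (proj2 (codel q' g' h' k _) (ex_intro _ (exist _ k qk) (conj erefl erefl))))).
case: _ / eqq g' h' e eqv => g' h' _ eqv.
have -> : h' = h.
  apply/funext => s.
  have /codel [s' [/sig_inj -> //]] := proj1 (eqv _)
    (proj2 (codel q g h _ _) (ex_intro _ s (conj erefl erefl))).
suff -> : g' = g by [].
apply/funext => s; symmetry; apply: IH; apply/funext => y; apply/propext; split=> cy.
  by have /coder [s' [/sig_inj -> //]] := proj1 (eqv _)
    (proj2 (coder q g h _ _) (ex_intro _ s (conj erefl cy))).
by have /coder [s' [/sig_inj -> //]] := proj2 (eqv _)
  (proj2 (coder q g' h' _ _) (ex_intro _ s (conj erefl cy))).
Qed.

Lemma card_le_tree : card_le (tree K) {P : K -> Prop | small K P}.
Proof.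
have [u Iu] : card_le (K * (K * K + K)) K.
  have [a [b ab]] := infinite_two infK; have sqK := card_le_square infK.
  apply: (card_le_trans _ sqK); apply: card_le_prod (card_le_refl K) _.
  apply: (card_le_trans (card_le_sum sqK (card_le_refl K))).
  exact: card_le_trans (card_le_sum_prod ab) sqK.
exists (fun w => exist _ (tree_code u w) (small_tree_code u w)) => w w' [].
exact: tree_code_inj.
Qed.

(* The chain condition of [K^X].  Let [c T] be a member of the family extending
   the partial function [T], and close the empty set under [T |-> c T] for the
   small [T] whose domain is covered by the domains of previous members.  Any
   [a] agrees on the domains covered by the closure with a member [a'] of it;
   then [a] and [a'] are compatible, so [a = a'] and the closure is everything.
   Since it is an image of [tree K], it has at most [K^{<K}] elements. *)
Lemma card_le_antichain (A X : Type) (D : A -> X -> Prop) (f : A -> X -> K) :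
  (forall a, small K (D a)) ->
  (forall a b, (forall x, D a x -> D b x -> f a x = f b x) -> a = b) ->
  card_le A {P : K -> Prop | small K P}.
Proof.
move=> DK incomp; case: (pselect (inhabited A)) => [[a0]|nA]; last first.
  have F (a : A) : False := nA (inhabits a).
  by exists (fun a => match F a return _ with end) => a; case: (F a).
(* [phi a] codes the coordinates in [D a] by elements of [K], so that tree labels can name them. *)
pose phi a := proj1_sig (cid (proj1 (DK a))).
have Iphi a : forall x y, phi a x = phi a y -> x = y := proj2_sig (cid (proj1 (DK a))).
pose E a k x := exists d : D a x, phi a (exist _ x d) = k.
have E_fun a k x y : E a k x -> E a k y -> x = y.
  by move=> [d <-] [d' /Iphi []].
pose ext (T : X -> K -> Prop) a := forall x v, T x v -> D a x /\ f a x = v.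
(* The value is the arbitrary [a0] when no member extends [T]. *)
have /choice [c cP] T : exists a, (exists a', ext T a') -> ext T a.
  by case: (pselect (exists a, ext T a)) => [[a aP]|na]; [exists a|exists a0].
apply: card_le_trans card_le_tree.
apply: (@card_le_surj _ _ (tree_eval E c)) => a.
(* The part of [D a] covered by the domains of members named by trees. *)
pose P x := D a x /\ exists w k, E (tree_eval E c w) k x.
have PK : small K P by apply: small_sub (DK a) => x [].
have [psi Ipsi] := proj1 PK.
pose q : {Q : K -> Prop | small K Q} := exist _ _ (small_range psi PK).
have /choice [t tP] : forall s : {k | proj1_sig q k}, exists t : tree K * (K * K),
    exists p : {x | P x}, proj1_sig s = psi p /\
      E (tree_eval E c t.1) t.2.1 (proj1_sig p) /\ t.2.2 = f a (proj1_sig p).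
  move=> [k [p kp]]; have [_ [w [k' Ewk]]] := proj2_sig p.
  by exists (w, (k', f a (proj1_sig p))), p.
(* One child for each point of [P], covering it and labelled with the value of [f a] there; hence
   the value of [w] agrees with [f a] on [P]. *)
pose w := @node K q (fun s => (t s).1) (fun s => (t s).2).
exists w; symmetry; apply: incomp => x Dax Dwx.
have extw : ext (fun x v => exists s, E (tree_eval E c (t s).1) (t s).2.1 x /\ v = (t s).2.2)
    (tree_eval E c w).
  apply: cP; exists a => y v [s [Ey ->]]; have [p [_ [Ep ->]]] := tP s.
  by rewrite (E_fun _ _ _ _ Ey Ep); split=> //; case: (proj2_sig p).
(* A coordinate shared by [a] and the value of [w] lies in [P], as [w] itself witnesses. *)
have Px : P x by split=> //; exists w, (phi _ (exist _ x Dwx)), Dwx.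
pose s : {k | proj1_sig q k} := exist _ (psi (exist _ x Px)) (ex_intro _ _ erefl).
symmetry; apply: (proj2 (extw _ _ _)); exists s.
by have [p [/Ipsi <- [Ep ->]]] := tP s.
Qed.

(** * From a homeomorphism to the cardinal inequality *)

(** A small set is coded by a bound and its characteristic function below the bound, hence by an
    element of [N * N]. If [K] did not inject into [N], then [N] would inject into a segment,
    against Cantor's theorem. *)
Lemma card_le_small_sets (N : Type) :
  (forall x, card_le (seg RK x -> bool) N) -> card_le {P : K -> Prop | small K P} N.
Proof.
move=> powN.
have KN : card_le K N.
  apply: contrapT => /card_lt_of_not_le /card_le_seg [b Nb].
  exact: cantor (card_le_trans (powN b) Nb).
apply: card_le_trans (card_le_square (infinite_mono KN infK)).
apply: card_le_trans (card_le_prod KN (card_le_refl N)).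
pose b (P : {P : K -> Prop | small K P}) := proj1_sig (cid (small_bounded (proj2_sig P))).
have bP P : forall x, proj1_sig P x -> RK x (b P) := proj2_sig (cid (small_bounded (proj2_sig P))).
pose j x := proj1_sig (cid (powN x)).
have Ij x : forall u v, j x u = j x v -> u = v := proj2_sig (cid (powN x)).
pose r (P : {P : K -> Prop | small K P}) x (s : seg RK x) := `[< proj1_sig P (proj1_sig s) >].
exists (fun P => (b P, j (b P) (r P (b P)))) => P P' [eb].
rewrite -eb => /Ij er; apply: sig_inj; apply/funext => x; apply/propext.
have rE (xb : RK x (b P)) : proj1_sig P x <-> proj1_sig P' x.
  have := f_equal (fun u => u (exist _ x xb)) er; rewrite /r /= => ePP'.
  by split=> /asboolP; [rewrite ePP'|rewrite -ePP'] => /asboolP.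
split=> Px; first exact: (proj1 (rE (bP P x Px))).
by apply: (proj2 (rE _)) => //; rewrite eb; exact: bP.
Qed.

(** The disjoint open sets [V m] pull back to disjoint open sets of K^M; a basic set around
    [G (fun _ => m)] inside each gives an antichain of size [M]. *)
Lemma le_two_pow_of_homeomorphic (M : Type) :
  card_le K M -> box_homeomorphic K M K M M -> le_two_pow_lt M RK.
Proof.
move=> KM [F [G [_ [FG [openF _]]]]] N powN.
apply: card_le_trans (card_le_small_sets powN).
have [m0 _] := infinite_mono KM infK nil.
pose V m (g : M -> M) := g m0 = m.
have openV m : box_open K (V m).
  move=> g gm; exists (fun x => x = m0); split; first exact: small_eq.
  by move=> h ag; rewrite /V ag.
have /choice [D DP] : forall m, exists D : M -> Prop, small K D /\
    forall h, (forall x, D x -> h x = G (fun _ => m) x) -> F h m0 = m.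
  move=> m; have [|D DP] := openF _ (openV m) (G (fun _ => m)); last by exists D.
  by rewrite /V FG.
apply: (@card_le_antichain _ _ D (fun m => G (fun _ => m))) => [m|m m' ag].
  exact: (proj1 (DP m)).
(* A common extension of two compatible basic conditions; its image takes both values [m] and [m']
   at [m0]. *)
pose h x := if pselect (D m x) then G (fun _ => m) x else G (fun _ => m') x.
have <- : F h m0 = m by apply: (proj2 (DP m)) => x Dx; rewrite /h; case: pselect.
apply: (proj2 (DP m')) => x Dx; rewrite /h; case: pselect => // Dmx.
exact: ag.
Qed.

End Regular.

Theorem mainTheorem5 (K : Type) (RK : K -> K -> Prop) (M : Type) (RM : M -> M -> Prop) :
  is_cardinal RK -> infinite K -> regular RK ->
  is_cardinal RM -> card_lt K M -> cofinality_is RM K ->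
  (box_homeomorphic K M K M M <-> le_two_pow_lt M RK).
Proof.
move=> cardK infK regK _ [KM _] _; split=> [homeo|le].
  exact: (le_two_pow_of_homeomorphic cardK infK regK KM homeo).
exact: (box_homeomorphic_of_iso cardK infK regK (iso_of_le_two_pow cardK infK regK KM le)).
Qed.
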